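(* Let $K\in\mathcal{K}^2$ be centrally symmetric and in Behrend-bisecting position. Then $$\frac{\mathrm{A}(K)}{\mathrm{D}_B(K)^2}\geq\frac{\sqrt{3}}{2}.$$
   Context: $\mathcal{K}^2$ is the family of planar convex bodies (compact convex subsets of $\mathbb{R}^2$) with non-empty interior. $K$ is centrally symmetric if $K=x-K$ for some $x\in\mathbb{R}^2$. For a compact set $S\subset\mathbb{R}^2$, $\mathrm{A}(S)$ is its area (2-dimensional Lebesgue measure) and $\mathrm{D}(S)$ its diameter (largest Euclidean distance between two points of $S$). A bisection of $K\in\mathcal{K}^2$ is a pair of closed sets $(K_1,K_2)$ such that (i) $K=K_1\cup K_2$, and (ii) $K_1\cap K_2=l([-1,1])$, where $l:[-1,1]\to K$ is an injective continuous curve whose endpoints $l(-1),l(1)$ are the only points of the curve lying in the boundary of $K$. $\mathcal{B}(K)$ is the set of all bisections of $K$, and $\mathrm{D}_B(K)=\inf_{(K_1,K_2)\in\mathcal{B}(K)}\max\{\mathrm{D}(K_1),\mathrm{D}(K_2)\}$. A set $K\in\mathcal{K}^2$ is in Behrend-bisecting position if $$\frac{\mathrm{A}(K)}{\mathrm{D}_B(K)^2}=\sup_{\phi}\frac{\mathrm{A}(\phi(K))}{\mathrm{D}_B(\phi(K))^2},$$ where $\phi$ ranges over all nonsingular affine maps $\phi:\mathbb{R}^2\to\mathbb{R}^2$. *)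

(* Defs.v *)
From HB Require Import structures.
From mathcomp Require Import all_boot all_order all_algebra.
From mathcomp Require Import all_classical all_reals all_analysis.
Set Implicit Arguments.
Unset Strict Implicit.
Unset Printing Implicit Defensive.
Import Order.TTheory GRing.Theory Num.Theory.
Import numFieldNormedType.Exports.
Local Open Scope classical_set_scope.
Local Open Scope ring_scope.

(* The norm carried by [R * R] is the max norm: it induces the usual topology,
   but Euclidean distances have to be taken from [eucl_dist]. *)
Notation plane R := (R * R)%type (only parsing).

Section PlanarBodies.
Context {R : realType}.
Implicit Types (S K : set (plane R)) (x y : plane R).

Definition eucl_dist x y : R :=
  Num.sqrt ((x.1 - y.1) ^+ 2 + (x.2 - y.2) ^+ 2).

Definition diam S : R := sup [set eucl_dist p.1 p.2 | p in S `*` S].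

Definition area S : R :=
  fine ((@lebesgue_measure R \x @lebesgue_measure R)%E S).

Definition boundary S : set (plane R) := closure S `\` interior S.

Definition convex_body K : Prop :=
  [/\ @convex_set R (plane R) K, compact K & interior K !=set0].

Definition centrally_symmetric K : Prop :=
  exists x : plane R, K = [set x - y | y in K].

(* [l] is a total function of which only the restriction to [-1, 1] matters. *)
Definition bisecting_curve K (l : R -> plane R) : Prop :=
  [/\ {within `[-1, 1], continuous l},
      {in `[-1, 1] &, injective l},
      l @` `[-1, 1] `<=` K &
      forall t : R, t \in `[-1, 1] -> (boundary K (l t) <-> t = -1 \/ t = 1)].

Definition bisections K : set (set (plane R) * set (plane R)) :=
  [set B | [/\ closed B.1, closed B.2, K = B.1 `|` B.2 &
     exists2 l, bisecting_curve K l & B.1 `&` B.2 = l @` `[-1, 1]]].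

(* For a convex body the set below is nonempty and bounded below by 0, so that
   the total operator [inf] is the genuine infimum. *)
Definition bisecting_diameter K : R :=
  inf [set Num.max (diam B.1) (diam B.2) | B in bisections K].

Definition isodiametric_ratio K : R := area K / bisecting_diameter K ^+ 2.

Definition nonsingular_affine : set (plane R -> plane R) :=
  [set phi | exists (f : {linear plane R -> plane R}) (b : plane R),
     bijective f /\ forall x, phi x = f x + b].

(* The supremum is taken in the extended reals: it is +oo, not a default value,
   if the ratios are unbounded. *)
Definition behrend_bisecting_position K : Prop :=
  (isodiametric_ratio K)%:E =
  ereal_sup [set (isodiametric_ratio (phi @` K))%:E | phi in nonsingular_affine].

End PlanarBodies.

(* Main.v *)
Require Import Defs.
From HB Require Import structures.
From mathcomp Require Import all_boot all_order all_algebra.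
From mathcomp Require Import all_classical all_reals all_analysis.
From mathcomp Require Import measurable_realfun.
From mathcomp Require Import ring lra.
Set Implicit Arguments.
Unset Strict Implicit.
Unset Printing Implicit Defensive.
Import Order.TTheory GRing.Theory Num.Theory.
Import numFieldNormedType.Exports.
Local Open Scope classical_set_scope.
Local Open Scope ring_scope.

(* Cut K by a line through its centre and let L be one of the two halves. Since
   the other half is a translate of -L, D_B(K) <= D(L), and A(K) = 2 A(L). An
   affine image of K is chosen for which the ellipse of least area containing
   L - L is the unit disc. By optimality of this ellipse, L has two chords of
   length 1 (its diameter) making an angle of at least 60 degrees; as in Behrend's
   reverse isodiametric inequality, this gives A(L) >= sqrt 3 / 4. The sup defining
   the Behrend-bisecting position carries the bound over to K. *)

(** * Quadratic forms and compactness *)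

(** [bisecting_diameter] is an infimum, so one cut is enough, and it may be fixed before the affine
    map is chosen. The image of L has diameter at most 1 exactly when the quadratic form q pulled
    back from the Euclidean plane is at most 1 on L - L. Areas are multiplied by the square root of
    det q, so the map to look for maximises det q under this constraint: this is where the ellipse
    of least area comes from, and the vectors of L - L with q = 1 are the chords of length 1. The
    delicate point is the angle between such chords; it comes from a first-order variation of det q.
    The constant is half of 1 times sin 60: a convex set with a chord of length 1 and extent at
    least sqrt 3 / 2 perpendicular to it has area at least sqrt 3 / 4, the area of the equilateral
    triangle of side 1. *)

Lemma continuous_fst_fst (T1 T2 T3 : topologicalType) :
  continuous (fun x : (T1 * T2) * T3 => x.1.1).
Proof. by move=> x; apply: (@continuous_comp _ _ _ fst fst); exact: cvg_fst. Qed.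

Lemma continuous_fst_snd (T1 T2 T3 : topologicalType) :
  continuous (fun x : (T1 * T2) * T3 => x.1.2).
Proof.
by move=> x; apply: (@continuous_comp _ _ _ fst snd); [exact: cvg_fst|exact: cvg_snd].
Qed.

Lemma continuous_snd_fst (T1 T2 T3 : topologicalType) :
  continuous (fun x : T1 * (T2 * T3) => x.2.1).
Proof.
by move=> x; apply: (@continuous_comp _ _ _ snd fst); [exact: cvg_snd|exact: cvg_fst].
Qed.

Lemma continuous_snd_snd (T1 T2 T3 : topologicalType) :
  continuous (fun x : T1 * (T2 * T3) => x.2.2).
Proof. by move=> x; apply: (@continuous_comp _ _ _ snd snd); exact: cvg_snd. Qed.

Section QuadraticForms.
Context {R : realType}.
Implicit Types (u v w : plane R) (a b c : R).

Definition cross u v : R := u.1 * v.2 - u.2 * v.1.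

Definition qform a b c w : R := a * w.1 ^+ 2 + 2 * c * w.1 * w.2 + b * w.2 ^+ 2.

Definition qpolar a b c u v : R :=
  a * u.1 * v.1 + c * (u.1 * v.2 + u.2 * v.1) + b * u.2 * v.2.

Lemma linear_form_continuous (e : plane R) : continuous (fun w : plane R => e.1 * w.1 + e.2 * w.2).
Proof.
move=> w; apply: cvgD.
  by apply: cvgM; [exact: cvg_cst|exact: cvg_fst].
by apply: cvgM; [exact: cvg_cst|exact: cvg_snd].
Qed.

Lemma qform_continuous a b c : continuous (qform a b c).
Proof.
move=> w; rewrite /qform.
apply: cvgD; [apply: cvgD|].
- by apply: cvgM; [exact: cvg_cst|apply: cvgM; exact: cvg_fst].
- apply: cvgM; [apply: cvgM; [exact: cvg_cst|exact: cvg_fst]|exact: cvg_snd].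
- by apply: cvgM; [exact: cvg_cst|apply: cvgM; exact: cvg_snd].
Qed.

Lemma compact_max_exists (T : topologicalType) (f : T -> R) (A : set T) :
  A !=set0 -> compact A -> continuous f ->
  exists2 x, A x & forall y, A y -> f y <= f x.
Proof.
move=> A0 cA cf; have [x xA H] := compact_EVT_max A0 cA (continuous_subspaceT cf).
by exists x; [rewrite inE in xA|move=> y yA; apply: H; rewrite inE].
Qed.

Lemma compact_ubound (T : topologicalType) (f : T -> R) (A : set T) :
  compact A -> continuous f -> exists2 M, 0 < M & forall y, A y -> f y <= M.
Proof.
move=> cA cf; have [->|/set0P A0] := eqVneq A set0; first by exists 1.
have [x _ H] := compact_max_exists A0 cA cf.
exists (Num.max 1 (f x)); first by rewrite lt_max ltr01.
by move=> y /H yA; rewrite le_max yA orbT.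
Qed.

Lemma closed_fun_ge (T : topologicalType) (f : T -> R) a :
  continuous f -> closed [set x | a <= f x].
Proof.
move=> cf; apply: (@preimage_closed _ _ f [set y | a <= y]); last exact: closed_ge.
by move=> x _; exact: cf.
Qed.

Lemma closed_fun_le (T : topologicalType) (f : T -> R) a :
  continuous f -> closed [set x | f x <= a].
Proof.
move=> cf; apply: (@preimage_closed _ _ f [set y | y <= a]); last exact: closed_le.
by move=> x _; exact: cf.
Qed.

(** Where [g < 0], adding [e * g] only lowers [q]. The rest of [A] is compact and has no point with
    [q = 1], so [q] keeps a positive distance from 1 there, and this gap absorbs [e * g] for small
    [e]. A first-order condition at the contact points thus yields a feasible perturbation on all of
    [A]. *)
Lemma compact_perturb (T : topologicalType) (q g : T -> R) (A : set T) :
  compact A -> continuous q -> continuous g ->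
  (forall x, A x -> q x <= 1) ->
  (forall x, A x -> q x = 1 -> g x < 0) ->
  exists2 e0, 0 < e0 &
    forall e, 0 < e -> e <= e0 -> forall x, A x -> q x + e * g x <= 1.
Proof.
move=> cA cq cg q1 qg.
pose B := A `&` [set x | 0 <= g x].
have cB : compact B by apply: compact_closedI => //; exact: closed_fun_ge.
have [M M0 gM] := compact_ubound cA cg.
have [B0|/set0P B0] := eqVneq B set0.
  exists 1 => // e e0 _ x xA.
  have gx : g x < 0 by rewrite ltNge; apply/negP => gx; suff: set0 x by []; rewrite -B0.
  by have := q1 _ xA; nra.
have [x0 [Ax0 gx0] qx0] := compact_max_exists B0 cB cq.
have q01 : q x0 < 1.
  rewrite lt_neqAle q1// andbT; apply/negP => /eqP /(qg _ Ax0).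
  by move: gx0 => /=; lra.
exists ((1 - q x0) / M); first by rewrite divr_gt0// subr_gt0.
move=> e e0; rewrite ler_pdivlMr// => eM x xA.
have [gx|gx] := ltP (g x) 0; first by have := q1 _ xA; nra.
have := qx0 x (conj xA gx); have := gM x xA; nra.
Qed.

(** Lagrange's identity for the form: for [u] and [v] of length 1 it reads cos^2 + sin^2 = 1, with
    [qpolar] as the cosine and the determinant times [cross u v ^+ 2] as the squared sine. *)
Lemma qform_cross a b c u v :
  qpolar a b c u v ^+ 2 + (a * b - c ^+ 2) * cross u v ^+ 2 =
  qform a b c u * qform a b c v.
Proof. by rewrite /qpolar /cross /qform; ring. Qed.

(** Cramer's rule writes [cross u v] times [w] as [cross w v] times [u] plus [cross u w] times [v];
    the form is evaluated on both sides. *)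
Lemma cross_combination a b c u v w :
  cross u v ^+ 2 * qform a b c w =
  cross w v ^+ 2 * qform a b c u + cross u w ^+ 2 * qform a b c v
  + 2 * (cross w v * cross u w) * qpolar a b c u v.
Proof. by rewrite /qpolar /cross /qform; ring. Qed.

End QuadraticForms.

(** * The ellipse of least area *)

Section MaximalForm.
Context {R : realType}.
Implicit Types (u v w : plane R) (a b c : R) (W : set (plane R)).

(** The ellipse of a positive definite form has area pi over the square root of the determinant, so
    the largest determinant means least area. The points on the axes bound [a] and [b], the two
    diagonal ones bound [c], and the feasible forms become a compact set. A small multiple of the
    Euclidean form is feasible, so the maximum is positive. *)
Lemma max_det_exists W r : 0 < r -> compact W ->
  W (r, 0) -> W (0, r) -> W (r, r) -> W (r, - r) ->
  exists a b c, [/\ 0 < a, 0 < b, 0 < a * b - c ^+ 2,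
    forall w, W w -> qform a b c w <= 1 &
    forall a' b' c', 0 <= a' -> 0 <= b' ->
      (forall w, W w -> qform a' b' c' w <= 1) ->
      a' * b' - c' ^+ 2 <= a * b - c ^+ 2].
Proof.
move=> r0 cW Wr0 W0r Wrr WrN.
pose N := (r ^+ 2)^-1.
have Nr : N * r ^+ 2 = 1 by rewrite mulVf// sqrf_eq0 gt_eqF.
have N0 : 0 < N by rewrite invr_gt0 exprn_gt0.
pose Fs := \bigcap_(w in W) [set x : (R * R) * R | qform x.1.1 x.1.2 x.2 w <= 1].
pose A := ((`[0, N] `*` `[0, N]) `*` `[- N, N]) `&` Fs.
have c11 : continuous (fun x : (R * R) * R => x.1.1).
  exact: continuous_fst_fst.
have c12 : continuous (fun x : (R * R) * R => x.1.2).
  exact: continuous_fst_snd.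
have c2 : continuous (fun x : (R * R) * R => x.2) by move=> x; exact: cvg_snd.
have cA : compact A.
  apply: compact_closedI.
    by apply: compact_setX; [apply: compact_setX|]; exact: segment_compact.
  apply: closed_bigI => w _; apply: closed_fun_le => x; rewrite /qform.
  apply: cvgD; [apply: cvgD|].
  - by apply: cvgM; [exact: c11|exact: cvg_cst].
  - apply: cvgM; last exact: cvg_cst.
    apply: cvgM; last exact: cvg_cst.
    by apply: cvgM; [exact: cvg_cst|exact: c2].
  - by apply: cvgM; [exact: c12|exact: cvg_cst].
have cdet : continuous (fun x : (R * R) * R => x.1.1 * x.1.2 - x.2 ^+ 2).
  move=> x; apply: cvgB; first by apply: cvgM; [exact: c11|exact: c12].
  by apply: cvgM; exact: c2.
have inA a b c : 0 <= a -> 0 <= b -> (forall w, W w -> qform a b c w <= 1) ->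
    A ((a, b), c).
  move=> a0 b0 H; split; last by move=> w Ww /=; exact: H.
  have := H _ Wr0; have := H _ W0r; have := H _ Wrr; have := H _ WrN.
  rewrite /qform/= => h1 h2 h3 h4.
  have r2 : 0 < r ^+ 2 by rewrite exprn_gt0.
  have aN : a <= N by rewrite -(ler_pM2r r2) Nr; nra.
  have bN : b <= N by rewrite -(ler_pM2r r2) Nr; nra.
  have cN : c <= N by rewrite -(ler_pM2r r2) Nr; nra.
  have cN' : - N <= c by rewrite -(ler_pM2r r2) mulNr Nr; nra.
  by rewrite /= !in_itv/= a0 b0 aN bN cN cN'.
have [M M0 HM] := compact_ubound cW (@qform_continuous R 1 1 0).
have eM : 0 <= M^-1 by rewrite invr_ge0 ltW.
have Wfeas w : W w -> qform M^-1 M^-1 0 w <= 1.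
  move=> /HM wM.
  have -> : qform M^-1 M^-1 0 w = qform 1 1 0 w / M by rewrite /qform; ring.
  by rewrite ler_pdivrMr// mul1r.
have Ae := inA _ _ _ eM eM Wfeas.
have [|[[a b] c] [[[+ +] _] Fabc] Hmax] := compact_max_exists _ cA cdet.
  by exists ((M^-1, M^-1), 0).
rewrite /= !in_itv/= => /andP[a0 _] /andP[b0 _].
have d0 : 0 < a * b - c ^+ 2.
  apply: lt_le_trans (Hmax _ Ae) => /=.
  by rewrite expr0n/= subr0 -expr2 exprn_gt0// invr_gt0.
have ane : a != 0 by apply/eqP => az; move: d0; rewrite az; nra.
have bne : b != 0 by apply/eqP => az; move: d0; rewrite az; nra.
exists a, b, c; split => //.
- by rewrite lt_neqAle eq_sym ane.
- by rewrite lt_neqAle eq_sym bne.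
- by move=> a' b' c' a'0 b'0 H; apply: (Hmax _ (inA _ _ _ a'0 b'0 H)).
Qed.

(* [k] is the derivative of the determinant along (p, q, s). *)
Lemma det_increase a b c p q s e1 : 0 < a -> 0 < b -> 0 < e1 ->
  let k := a * q + b * p - 2 * c * s in 0 < k ->
  exists e, [/\ 0 < e <= e1, 0 <= a + e * p, 0 <= b + e * q &
    a * b - c ^+ 2 < (a + e * p) * (b + e * q) - (c + e * s) ^+ 2].
Proof.
move=> a0 b0 e10 k k0.
pose l := `|p * q - s ^+ 2| + 1.
have l0 : 0 < l by rewrite ltr_wpDl.
(* [e2] and [e3] keep the diagonal entries nonnegative; [e4] keeps the second-order term
   [e * (p * q - s ^+ 2)] above [- k / 2]. The added 1 avoids a zero denominator. *)
pose e2 := a / (`|p| + 1); pose e3 := b / (`|q| + 1); pose e4 := k / (2 * l).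
have p1 : 0 < `|p| + 1 by rewrite ltr_wpDl.
have q1 : 0 < `|q| + 1 by rewrite ltr_wpDl.
have e20 : 0 < e2 by rewrite divr_gt0.
have e30 : 0 < e3 by rewrite divr_gt0.
have e40 : 0 < e4 by rewrite divr_gt0// mulr_gt0.
exists (Num.min (Num.min e1 e2) (Num.min e3 e4)).
set e := Num.min _ _.
have e0 : 0 < e by rewrite !lt_min e10 e20 e30 e40.
have ee1 : e <= e1 by rewrite !ge_min lexx.
have ee2 : e * (`|p| + 1) <= a by rewrite -ler_pdivlMr// !ge_min lexx orbT.
have ee3 : e * (`|q| + 1) <= b by rewrite -ler_pdivlMr// !ge_min lexx !orbT.
have ee4 : e * (2 * l) <= k.
  by rewrite -ler_pdivlMr ?mulr_gt0// !ge_min lexx !orbT.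
have pN : - `|p| <= p by rewrite lerNl -normrN ler_norm.
have qN : - `|q| <= q by rewrite lerNl -normrN ler_norm.
have lN : - l < p * q - s ^+ 2.
  by rewrite ltrNl (le_lt_trans (ler_norm _))// normrN /l ltrDl.
split; [by rewrite e0|nra|nra|].
have -> : (a + e * p) * (b + e * q) - (c + e * s) ^+ 2 =
  a * b - c ^+ 2 + e * (k + e * (p * q - s ^+ 2)) by rewrite /k; ring.
by rewrite ltrDl mulr_gt0//; nra.
Qed.

(* [qform a b c <= 1] is the ellipse of least area containing [W]. If all its
   contact points with [W] made angles less than 60 degrees, they would lie
   between two of them, [u] and [v]; there [cross u w * cross v w <= 0], so that
   adding a small multiple of this form, corrected by [- eta * qform a b c], would
   keep [W] inside and increase the determinant. *)
Lemma large_contact_cross W r : 0 < r -> compact W ->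
  W (r, 0) -> W (0, r) -> W (r, r) -> W (r, - r) ->
  exists a b c u v, [/\ 0 < a * b - c ^+ 2,
    forall w, W w -> qform a b c w <= 1,
    W u /\ W v, qform a b c u = 1 &
    3 / 4 <= (a * b - c ^+ 2) * cross u v ^+ 2].
Proof.
move=> r0 cW Wr0 W0r Wrr WrN.
have [a [b [c [a0 b0 d0 QW dmax]]]] := max_det_exists r0 cW Wr0 W0r Wrr WrN.
exists a, b, c.
set d := a * b - c ^+ 2.
have noG p q s : 0 < a * q + b * p - 2 * c * s ->
    ~ (forall w, W w -> qform a b c w = 1 -> qform p q s w < 0).
  move=> k0 H.
  have [e1 e10 He1] := compact_perturb cW (@qform_continuous R a b c)
    (@qform_continuous R p q s) QW H.
  have [e [/andP[e0 ee1] ha hb]] := det_increase a0 b0 e10 k0.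
  apply/negP; rewrite -leNgt; apply: dmax => // w Ww.
  have -> : qform (a + e * p) (b + e * q) (c + e * s) w =
    qform a b c w + e * qform p q s w by rewrite /qform; ring.
  exact: He1.
pose C := W `&` [set w | 1 <= qform a b c w].
have QC w : C w -> qform a b c w = 1.
  by move=> [Ww /= w1]; apply/eqP; rewrite eq_le w1 QW.
have cC : compact C.
  by apply: compact_closedI => //; exact: closed_fun_ge (@qform_continuous R _ _ _).
have [C0|/set0P[w0 Cw0]] := eqVneq C set0.
  exfalso; apply: (noG a b c); first by rewrite /d in d0; lra.
  move=> w Ww Qw; suff: set0 w by [].
  by rewrite -C0; split => //=; rewrite Qw.
have ccross : continuous (fun x : plane R * plane R => cross x.1 x.2 ^+ 2).
  move=> x; rewrite /cross.
  have h1 := @continuous_fst_fst R R (plane R) x.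
  have h2 := @continuous_fst_snd R R (plane R) x.
  have h3 := @continuous_snd_fst (plane R) R R x.
  have h4 := @continuous_snd_snd (plane R) R R x.
  by apply: cvgM; apply: cvgB; apply: cvgM.
have [|[u v] [/= Cu Cv] Huv] := compact_max_exists _ (compact_setX cC cC) ccross.
  by exists (w0, w0).
exists u, v; split => //; [by split; [case: Cu|case: Cv]|exact: QC|].
rewrite leNgt; apply/negP => small.
set B := qpolar a b c u v.
have BE : B ^+ 2 + d * cross u v ^+ 2 = 1.
  by rewrite qform_cross (QC _ Cu) (QC _ Cv) mulr1.
have B1 : 1 / 4 < B ^+ 2 by lra.
(* The sign amounts to replacing [v] by [- v] when needed, so that the angle with [u] is acute. *)
pose sg : R := if 0 <= B then 1 else - 1.
have sgB : 1 / 2 < sg * B.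
  rewrite /sg; move: (B) B1 => x x1; have [x0|x0] := leP 0 x.
    by rewrite mul1r ltNge; apply/negP => x2; nra.
  by rewrite mulN1r ltNge; apply/negP => x2; nra.
have sg1 : sg ^+ 2 = 1 by rewrite /sg; case: ifP => _; ring.
(* With [eta * d = 1 / 8] the correction costs 1 / 4 in the derivative of the determinant, less than
   the [sg * B > 1 / 2] gained from the product of cross products. *)
pose eta := (8 * d)^-1.
have eta0 : 0 < eta by rewrite invr_gt0 mulr_gt0.
have etad : 8 * (eta * d) = 1 by rewrite mulrCA mulrC mulfV// gt_eqF// mulr_gt0.
apply: (noG (sg * (u.2 * v.2) - eta * a) (sg * (u.1 * v.1) - eta * b)
            (- sg * (u.1 * v.2 + u.2 * v.1) / 2 - eta * c)).
  have -> : a * (sg * (u.1 * v.1) - eta * b) + b * (sg * (u.2 * v.2) - eta * a)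
    - 2 * c * (- sg * (u.1 * v.2 + u.2 * v.1) / 2 - eta * c)
    = sg * B - 2 * (eta * d) by rewrite /B /qpolar /d; field.
  lra.
move=> w Ww Qw.
have -> : qform (sg * (u.2 * v.2) - eta * a) (sg * (u.1 * v.1) - eta * b)
    (- sg * (u.1 * v.2 + u.2 * v.1) / 2 - eta * c) w =
    sg * (cross u w * cross v w) - eta * qform a b c w.
  by rewrite /qform /cross; field.
rewrite Qw mulr1.
have Cw : C w by split => //=; rewrite Qw.
have := Huv (u, w) (conj Cu Cw); have := Huv (w, v) (conj Cw Cv) => /=.
have := cross_combination a b c u v w.
rewrite Qw (QC _ Cu) (QC _ Cv) !mulr1 -/B.
have -> : cross v w = - cross w v by rewrite /cross; ring.
set X := cross w v; set Y := cross u w; set S := cross u v => SE XS YS.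
suff : 0 <= sg * (X * Y) by nra.
rewrite leNgt; apply/negP => XY0.
have h : sg * (X * Y) * (sg * B) = X * Y * B.
  by transitivity (sg ^+ 2 * (X * Y * B)); [ring|rewrite sg1 mul1r].
have h2 : X * Y * B < sg * (X * Y) / 2 by rewrite -h; nra.
have h3 : (sg * (X * Y)) ^+ 2 = X ^+ 2 * Y ^+ 2.
  by rewrite exprMn sg1 mul1r exprMn.
(* Since [Z] is negative with square [P * Q], the sum [P + Q + Z] is at most the larger of [P] and
   [Q]; but [S ^+ 2] lies strictly below this sum, against the maximality of [cross u v ^+ 2] over
   pairs of contact points. *)
move: SE XS YS XY0 h2 h3; set Z := sg * (X * Y); set P := X ^+ 2; set Q := Y ^+ 2.
have : 0 <= P by rewrite sqr_ge0.
have : 0 <= Q by rewrite sqr_ge0.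
move=> Q0 P0 SE PS QS Z0 h2 h3.
have [PQ|PQ] := leP P Q; nra.
Qed.

End MaximalForm.

(** * Area of convex sets with a vertical chord *)

Section PlaneMeasure.
Context {R : realType}.
Local Notation mu := (@lebesgue_measure R).
Local Notation mT := (measurableTypeR R).

(** Links the product topology to the product sigma-algebra: [U] is the countable union of the boxes
    with rational centre and radius that it contains. *)
Lemma open_measurable_plane (U : set (plane R)) : open U ->
  measurable (U : set (mT * mT)).
Proof.
move=> oU.
have -> : U = \bigcup_(a : rat) \bigcup_(b : rat) \bigcup_(e : rat)
    ((ball (ratr a : R) (ratr e : R) `*` ball (ratr b : R) (ratr e : R)) `&`
     [set _ | ball (ratr a : R) (ratr e : R) `*` ball (ratr b : R) (ratr e : R) `<=` U]).
  apply/seteqP; split=> [[x y] Uxy|x [a _ [b _ [e _ [xin /= sub]]]]]; last exact: sub.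
  have : nbhs (x, y) U by apply: open_nbhs_nbhs.
  move=> /nbhs_ballP[r /= r0 rU].
  have r2 : 0 < r / 2 by rewrite divr_gt0.
  have [e] := @rat_in_itvoo R 0 (r / 2) r2; rewrite in_itv/= => /andP[e0 er].
  have [a] := @rat_in_itvoo R (x - ratr e) (x + ratr e) ltac:(lra).
  rewrite in_itv/= => /andP[a1 a2].
  have [b] := @rat_in_itvoo R (y - ratr e) (y + ratr e) ltac:(lra).
  rewrite in_itv/= => /andP[b1 b2].
  exists a => //; exists b => //; exists e => //; split.
    by split; rewrite /= /ball/= ltr_norml; apply/andP; split; lra.
  move=> [x' y'] [] /=; rewrite /ball/= !ltr_norml => /andP[x1 x2] /andP[y1 y2].
  by apply: rU; split; rewrite /= /ball/= ltr_norml; apply/andP; split; lra.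
apply: bigcupT_measurable_rat => a; apply: bigcupT_measurable_rat => b.
apply: bigcupT_measurable_rat => e.
set P := (X in [set _ | X]).
have [p|np] := pselect P.
  rewrite (_ : [set _ | P] = setT); last by apply/seteqP; split.
  by rewrite setIT; apply: measurableX; rewrite ball_itv; exact: measurable_itv.
by rewrite (_ : [set _ | P] = set0) ?setI0//; apply/seteqP; split.
Qed.

Lemma closed_measurable_plane (F : set (plane R)) : closed F ->
  measurable (F : set (mT * mT)).
Proof.
by move=> cF; rewrite -[F]setCK; apply: measurableC; apply: open_measurable_plane;
  exact: closed_openC.
Qed.

Lemma integral_linear (p q k : R) : p < q ->
  (\int[mu]_(x in `[p, q]) (k * (x - p))%:E = (k * (q - p) ^+ 2 / 2)%:E)%E.
Proof.
move=> pq.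
pose F (x : R) : R := k * (x - p) ^+ 2 / 2.
have dF (x : R) : is_derive x 1 F (k * (x - p)).
  rewrite /F; apply: is_derive_eq.
  by rewrite /GRing.scale/=; field.
have cF : continuous F.
  by move=> x; apply: differentiable_continuous; apply/derivable1_diffP.
rewrite (@continuous_FTC2 R (fun x => k * (x - p)) F p q pq).
- by rewrite -EFinB; congr EFin; rewrite /F; ring.
- apply: continuous_subspaceT => x.
  by apply: cvgM; [exact: cvg_cst|apply: cvgB; [exact: cvg_id|exact: cvg_cst]].
- split.
  + by move=> x _; case: (dF x).
  + exact: cvg_at_right_filter (cF p).
  + exact: cvg_at_left_filter (cF q).
- by move=> x _; rewrite derive1E; case: (dF x).
Qed.

Lemma integral_linear_rev (p q k : R) : p < q ->
  (\int[mu]_(x in `[p, q]) (k * (q - x))%:E = (k * (q - p) ^+ 2 / 2)%:E)%E.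
Proof.
move=> pq.
pose F (x : R) : R := - (k * (q - x) ^+ 2 / 2).
have dF (x : R) : is_derive x 1 F (k * (q - x)).
  rewrite /F; apply: is_derive_eq.
  by rewrite /GRing.scale/=; field.
have cF : continuous F.
  by move=> x; apply: differentiable_continuous; apply/derivable1_diffP.
rewrite (@continuous_FTC2 R (fun x => k * (q - x)) F p q pq).
- by rewrite -EFinB; congr EFin; rewrite /F; ring.
- apply: continuous_subspaceT => x.
  by apply: cvgM; [exact: cvg_cst|apply: cvgB; [exact: cvg_cst|exact: cvg_id]].
- split.
  + by move=> x _; case: (dF x).
  + exact: cvg_at_right_filter (cF p).
  + exact: cvg_at_left_filter (cF q).
- by move=> x _; rewrite derive1E; case: (dF x).
Qed.

Lemma line_null (a b : R) : (a, b) != (0, 0) ->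
  (mu \x mu)%E [set w : plane R | a * w.1 + b * w.2 = 0] = 0%E.
Proof.
move=> ab0; rewrite /product_measure1.
have [b0|b0] := eqVneq b 0.
  have a0 : a != 0 by move: ab0; rewrite b0 xpair_eqE eqxx andbT.
  rewrite (_ : [set w : plane R | _] = [set 0] `*` [set: R]).
    have := @product_measure1E _ _ mT mT R mu mu [set 0] [set: R]
      (measurable_set1 0) measurableT.
    rewrite /product_measure1 => ->.
    by rewrite [X in (X * _)%E](_ : _ = 0%E) ?mul0e//; exact: lebesgue_measure_set1.
  apply/seteqP; split => [[x y]|[x y] [/= -> _]]; rewrite /= b0 ?mul0r ?mulr0 ?addr0//.
  by move=> /eqP; rewrite mulf_eq0 (negPf a0) => /eqP.
rewrite (eq_integral (fun=> 0%E)) ?integral0// => x _ /=.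
have -> : xsection [set w : plane R | a * w.1 + b * w.2 = 0] x = [set - (a * x) / b].
  apply/seteqP; split => y; rewrite /xsection/= inE/=.
    by move=> h; apply: (mulIf b0); rewrite divfK//; lra.
  by move=> ->; field.
exact: lebesgue_measure_set1.
Qed.

End PlaneMeasure.

Section ChordArea.
Context {R : realType}.
Local Notation mu := (@lebesgue_measure R).
Local Notation mT := (measurableTypeR R).
Implicit Types (L : set (plane R)) (p q : plane R).

(** Convexity in coordinates, a form that passes directly to half-planes and affine images. *)
Definition segment_closed L := forall p q (t : R), 0 <= t <= 1 -> L p -> L q ->
  L (t * p.1 + (1 - t) * q.1, t * p.2 + (1 - t) * q.2).

Lemma segment_closed_vertical L x y1 y2 y : segment_closed L ->
  L (x, y1) -> L (x, y2) -> y1 <= y <= y2 -> L (x, y).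
Proof.
move=> cL L1 L2 /andP[yy1 yy2].
have [y12|y12] := leP y2 y1; first by have -> : y = y1 by lra.
have d0 : 0 < y2 - y1 by rewrite subr_gt0.
have t01 : 0 <= (y2 - y) / (y2 - y1) <= 1.
  by rewrite divr_ge0 ?subr_ge0 ?(ltW y12)//= ler_pdivrMr// mul1r; lra.
have := cL _ _ _ t01 L1 L2 => /=.
suff -> : (y2 - y) / (y2 - y1) * x + (1 - (y2 - y) / (y2 - y1)) * x = x.
  by congr L; congr pair; field; rewrite gt_eqF.
by ring.
Qed.

Lemma le_xsection_measure L x y1 y2 : measurable (L : set (mT * mT)) ->
  segment_closed L -> L (x, y1) -> L (x, y2) ->
  ((y2 - y1)%:E <= mu (xsection L x))%E.
Proof.
move=> mL cL L1 L2.
have [y12|y12] := leP y2 y1.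
  by apply: (@le_trans _ _ 0%E) => //; rewrite lee_fin subr_le0.
have <- : mu `[y1, y2] = (y2 - y1)%:E.
  by rewrite lebesgue_measure_itv/= lte_fin y12 EFinB.
apply: le_measure; rewrite ?inE.
- exact: measurable_itv.
- exact: measurable_xsection.
- move=> y; rewrite /= in_itv/= => yy.
  by rewrite /xsection/= inE; exact: segment_closed_vertical L1 L2 yy.
Qed.

Section Halves.
Variables (L : set (plane R)) (x0 y0 h : R).
Hypotheses (mL : measurable (L : set (mT * mT))) (cL : segment_closed L).
Hypotheses (L0 : L (x0, y0)) (Lh : L (x0, y0 + h)).

Let f (x : mT) : \bar R := mu (xsection L x).

Let mf (D : set mT) : measurable D -> measurable_fun D f.
Proof.
move=> mD; apply: (@measurable_funS _ _ mT _ setT) => //.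
exact: (@measurable_fun_xsection _ _ mT mT R mu L mL).
Qed.

Let mlin (D : set mT) (g : R -> R) : measurable D -> continuous g ->
  measurable_fun D (fun x : mT => (g x)%:E).
Proof.
move=> mD cg; apply/measurable_EFinP; apply: (@measurable_funS _ _ mT _ setT) => //.
exact: continuous_measurable_fun.
Qed.

(** [L] contains the triangle spanned by the chord and [b], whose section at [x] has length
    [h * (b.1 - x) / (b.1 - x0)]. *)
Lemma half_chord_right b : 0 <= h -> x0 <= b.1 -> L b ->
  ((h * (b.1 - x0) / 2)%:E <= \int[mu]_(x in `[x0, b.1]) f x)%E.
Proof.
move=> h0; rewrite le_eqVlt => /predU1P[<- _|xb Lb].
  by rewrite subrr mulr0 mul0r; exact: integral_ge0.
have d0 : 0 < b.1 - x0 by rewrite subr_gt0.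
have dn : b.1 - x0 != 0 by rewrite gt_eqF.
have -> : h * (b.1 - x0) / 2 = h / (b.1 - x0) * (b.1 - x0) ^+ 2 / 2 by field.
rewrite -integral_linear_rev//; apply: ge0_le_integral => //.
- move=> x; rewrite /= in_itv/= => /andP[x1 x2].
  by rewrite lee_fin mulr_ge0// ?subr_ge0// divr_ge0// ltW.
- apply: mlin => [|x]; first exact: measurable_itv.
  by apply: cvgM; [exact: cvg_cst|apply: cvgB; [exact: cvg_cst|exact: cvg_id]].
- exact: mf.
move=> x; rewrite /= in_itv/= => /andP[x1 x2].
set t := (b.1 - x) / (b.1 - x0).
have t01 : 0 <= t <= 1.
  by rewrite /t divr_ge0 ?subr_ge0 ?(ltW xb)//= ler_pdivrMr// mul1r; lra.
have ex : t * x0 + (1 - t) * b.1 = x by rewrite /t; field.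
have := cL t01 Lh Lb; have := cL t01 L0 Lb => /=; rewrite ex => A1 A2.
have := le_xsection_measure mL cL A1 A2.
by congr (_ <= _)%E; congr EFin; rewrite /t; field.
Qed.

Lemma half_chord_left a : 0 <= h -> a.1 <= x0 -> L a ->
  ((h * (x0 - a.1) / 2)%:E <= \int[mu]_(x in `[a.1, x0]) f x)%E.
Proof.
move=> h0; rewrite le_eqVlt => /predU1P[-> _|xb La].
  by rewrite subrr mulr0 mul0r; exact: integral_ge0.
have d0 : 0 < x0 - a.1 by rewrite subr_gt0.
have dn : x0 - a.1 != 0 by rewrite gt_eqF.
have -> : h * (x0 - a.1) / 2 = h / (x0 - a.1) * (x0 - a.1) ^+ 2 / 2 by field.
rewrite -integral_linear//; apply: ge0_le_integral => //.
- move=> x; rewrite /= in_itv/= => /andP[x1 x2].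
  by rewrite lee_fin mulr_ge0// ?subr_ge0// divr_ge0// ltW.
- apply: mlin => [|x]; first exact: measurable_itv.
  by apply: cvgM; [exact: cvg_cst|apply: cvgB; [exact: cvg_id|exact: cvg_cst]].
- exact: mf.
move=> x; rewrite /= in_itv/= => /andP[x1 x2].
set t := (x - a.1) / (x0 - a.1).
have t01 : 0 <= t <= 1.
  by rewrite /t divr_ge0 ?subr_ge0 ?(ltW xb)//= ler_pdivrMr// mul1r; lra.
have ex : t * x0 + (1 - t) * a.1 = x by rewrite /t; field.
have := cL t01 Lh La; have := cL t01 L0 La => /=; rewrite ex => A1 A2.
have := le_xsection_measure mL cL A1 A2.
by congr (_ <= _)%E; congr EFin; rewrite /t; field.
Qed.

Lemma chord_area p q : 0 <= h -> L p -> L q ->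
  ((h * (q.1 - p.1) / 2)%:E <= (mu \x mu)%E L)%E.
Proof.
move=> h0 Lp Lq.
(* The chord is the common base of two triangles, one on each side. If [q] or [p] is on the wrong
   side, [(x0, y0)] replaces it and that triangle degenerates. *)
have [b [Lb b0 bq]] : exists b, [/\ L b, x0 <= b.1 & q.1 <= b.1].
  by have [?|/ltW ?] := leP x0 q.1; [exists q|exists (x0, y0)].
have [a [La a0 ap]] : exists a, [/\ L a, a.1 <= x0 & a.1 <= p.1].
  by have [?|/ltW ?] := leP p.1 x0; [exists p|exists (x0, y0)].
apply: (@le_trans _ _ (\int[mu]_(x in `[a.1, x0[ `|` `[x0, b.1]) f x)%E); last first.
  apply: ge0_subset_integral => //.
    by apply: measurableU; exact: measurable_itv.
  exact: mf.
rewrite ge0_integral_setU//; [|by apply: mf; apply: measurableU; exact: measurable_itv|]; last first.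
  apply/disj_setPS => x [] /=; rewrite !in_itv/= => /andP[_ x1] /andP[x2 _].
  by move: x1; rewrite ltNge x2.
rewrite integral_itv_bndo_bndc; last by apply: mf; exact: measurable_itv.
apply: le_trans (leeD (half_chord_left h0 a0 La) (half_chord_right h0 b0 Lb)).
rewrite -EFinD lee_fin.
have -> : h * (x0 - a.1) / 2 + h * (b.1 - x0) / 2 = h * (b.1 - a.1) / 2 by field.
by rewrite ler_pM2r// ler_wpM2l// lerB.
Qed.

End Halves.

Lemma convex_set_segment_closed L : @convex_set R (plane R) L -> segment_closed L.
Proof.
move=> cL p q t t01 Lp Lq.
have t01' : (0 <= t) && (t <= 1) by [].
have := cL p q (Itv01 (andP t01').1 (andP t01').2).
by rewrite !inE => /(_ Lp Lq).
Qed.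

End ChordArea.

(** * Bisections by a line through the centre *)

Section Bisections.
Context {R : realType}.
Implicit Types (K S : set (plane R)) (p q v w : plane R).

Lemma eucl_dist_ge0 p q : 0 <= eucl_dist p q.
Proof. exact: sqrtr_ge0. Qed.

Lemma diam_le S M : S !=set0 -> (forall p q, S p -> S q -> eucl_dist p q <= M) ->
  diam S <= M.
Proof.
move=> [p Sp] H; apply: ge_sup; first by exists (eucl_dist p p), (p, p).
by move=> _ [[x y] [/= Sx Sy] <-]; exact: H.
Qed.

Lemma eucl_dist_continuous : continuous (fun x : plane R * plane R => eucl_dist x.1 x.2).
Proof.
move=> x; rewrite /eucl_dist.
apply: (@continuous_comp _ _ _ (fun x : plane R * plane R =>
  (x.1.1 - x.2.1) ^+ 2 + (x.1.2 - x.2.2) ^+ 2) Num.sqrt); last exact: sqrt_continuous.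
have h1 := @continuous_fst_fst R R (plane R) x.
have h2 := @continuous_fst_snd R R (plane R) x.
have h3 := @continuous_snd_fst (plane R) R R x.
have h4 := @continuous_snd_snd (plane R) R R x.
by apply: cvgD; apply: cvgM; apply: cvgB.
Qed.

Lemma le_diam K S p q : compact K -> S `<=` K -> S p -> S q ->
  eucl_dist p q <= diam S.
Proof.
move=> cK SK Sp Sq; apply: sup_upper_bound; last by exists (p, q).
split; first by exists (eucl_dist p q), (p, q).
have [M _ HM] := compact_ubound (compact_setX cK cK) eucl_dist_continuous.
by exists M => _ [x [/SK x1 /SK x2] <-]; exact: HM.
Qed.

Lemma nbhs_box p S : nbhs p S -> exists2 r, 0 < r &
  forall q, `|q.1 - p.1| < r -> `|q.2 - p.2| < r -> S q.
Proof.
move=> /nbhs_ballP[r /= r0 rS]; exists r => // q q1 q2; apply: rS.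
by split; rewrite /ball/= distrC.
Qed.

Section SymmetricBody.
Variables (K : set (plane R)) (r : R).
Hypotheses (r0 : 0 < r) (cK : compact K) (sK : segment_closed K).
Hypothesis boxK : forall q, `|q.1| < r -> `|q.2| < r -> K q.
Hypothesis symK : forall q, K q -> K (- q.1, - q.2).

Let closedK : closed K.
Proof. exact: compact_closed. Qed.

(** Contracting the box towards [w] gives a box of radius [(1 - t) * r] around [t * w], which
    convexity keeps inside [K]. *)
Lemma scale_interior w t : K w -> 0 <= t < 1 -> interior K (t * w.1, t * w.2).
Proof.
move=> Kw /andP[t0 t1].
have e0 : 0 < 1 - t by rewrite subr_gt0.
apply/nbhs_ballP; exists ((1 - t) * r); first by rewrite /= mulr_gt0.
move=> [x y] []; rewrite /ball/= => h1 h2.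
have t01 : 0 <= t <= 1 by rewrite t0 ltW.
have Kz : K ((x - t * w.1) / (1 - t), (y - t * w.2) / (1 - t)).
  by apply: boxK => /=; rewrite normrM normfV (gtr0_norm e0) ltr_pdivrMr//
    [r * _]mulrC distrC.
have := sK t01 Kw Kz => /=.
by congr K; congr pair; field; rewrite gt_eqF.
Qed.

(** The halves meet in a chord through the centre. By symmetry it runs from [- v] to [v], with [v]
    its farthest point in the direction [(- e2, e1)], and the curve is [t * v]. *)
Lemma bisect_by_line (e : plane R) : e != (0, 0) ->
  bisections K (K `&` [set w | 0 <= e.1 * w.1 + e.2 * w.2],
                K `&` [set w | e.1 * w.1 + e.2 * w.2 <= 0]).
Proof.
case: e => e1 e2 e0 /=.
have cg (a b : R) : continuous (fun w : plane R => a * w.1 + b * w.2).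
  exact: (@linear_form_continuous R (a, b)).
have N0 : 0 < e1 ^+ 2 + e2 ^+ 2.
  rewrite lt_neqAle addr_ge0 ?sqr_ge0// andbT eq_sym paddr_eq0 ?sqr_ge0//.
  by rewrite !sqrf_eq0 -xpair_eqE.
pose g (w : plane R) := e1 * w.1 + e2 * w.2.
pose s (w : plane R) := - e2 * w.1 + e1 * w.2.
pose A := K `&` [set w | 0 <= g w] `&` [set w | g w <= 0].
have cA : compact A.
  apply: compact_closedI; last by apply: closed_fun_le; exact: cg.
  by apply: compact_closedI => //; apply: closed_fun_ge; exact: cg.
have AE w : A w <-> K w /\ g w = 0.
  split=> [[[Kw /= g0] g1]|[Kw gw]]; last by split; [split|]; rewrite //= gw.
  by split => //; apply/eqP; rewrite eq_le g0 g1.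
(* This scale puts a nonzero point of the line inside the box, so the chord is not reduced to the
   centre. *)
pose z := r / (2 * (`|e1| + `|e2| + 1)).
have M0 : 0 < `|e1| + `|e2| + 1 by rewrite ltr_wpDl ?addr_ge0.
have z0 : 0 < z by rewrite divr_gt0// mulr_gt0.
have zM : z * (`|e1| + `|e2| + 1) = r / 2 by rewrite /z; field; rewrite gt_eqF.
have Az : A (z * - e2, z * e1).
  apply/AE; split; last by rewrite /g/=; ring.
  have ze1 : 0 <= z * `|e1| by rewrite mulr_ge0// ltW.
  have ze2 : 0 <= z * `|e2| by rewrite mulr_ge0// ltW.
  by apply: boxK; rewrite /= normrM ?normrN (gtr0_norm z0); move: zM ze1 ze2; rewrite !mulrDr; lra.
have [|v Av sv] := compact_max_exists _ cA (cg (- e2) e1).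
  by exists (z * - e2, z * e1).
have [Kv gv] := (AE v).1 Av.
have m0 : 0 < s v.
  apply: lt_le_trans (sv _ Az); rewrite /= -/(s v).
  have -> : - e2 * (z * - e2) + e1 * (z * e1) = z * (e1 ^+ 2 + e2 ^+ 2) by ring.
  exact: mulr_gt0.
have mn : s v != 0 by rewrite gt_eqF.
have vE w : g w = 0 -> w = (s w / s v * v.1, s w / s v * v.2).
  case: w => w1 w2 gw.
  have N : e1 ^+ 2 + e2 ^+ 2 != 0 by rewrite gt_eqF.
  have h1 : (e1 ^+ 2 + e2 ^+ 2) * w1 = e1 * g (w1, w2) - e2 * s (w1, w2).
    by rewrite /g/s/=; ring.
  have h2 : (e1 ^+ 2 + e2 ^+ 2) * w2 = e2 * g (w1, w2) + e1 * s (w1, w2).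
    by rewrite /g/s/=; ring.
  have k1 : (e1 ^+ 2 + e2 ^+ 2) * v.1 = e1 * g v - e2 * s v by rewrite /g/s; ring.
  have k2 : (e1 ^+ 2 + e2 ^+ 2) * v.2 = e2 * g v + e1 * s v by rewrite /g/s; ring.
  by congr pair; apply: (mulfI N); rewrite mulrCA ?k1 ?k2 ?h1 ?h2 gw gv; field.
pose l (t : R) : plane R := (t * v.1, t * v.2).
have Kl t : `|t| <= 1 -> K (l t).
  rewrite ler_norml => /andP[t1 t2].
  have t01 : 0 <= (1 + t) / 2 <= 1 by lra.
  have := sK t01 Kv (symK Kv) => /=.
  by congr K; congr pair; field.
have vne : v != (0, 0).
  apply/eqP => v0; move: m0; rewrite v0 /s/= !mulr0 addr0 ltxx//.
have lI : {in `[-1, 1] &, injective l}.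
  move=> t u _ _ [h1 h2]; apply/eqP; rewrite -subr_eq0.
  apply: contraT => tu.
  have : (t - u) * v.1 == 0 by rewrite mulrBl h1 subrr.
  have : (t - u) * v.2 == 0 by rewrite mulrBl h2 subrr.
  rewrite !mulf_eq0 (negPf tu)/= => v2 v1.
  by move: vne; rewrite -pair_eqE/= /pair_eq/= v1 v2.
(* From an interior endpoint one could move on to [(1 + y) * v], up to sign, still in [K] and on the
   line but beyond the maximiser [v]. *)
have notint t : `|t| = 1 -> ~ interior K (l t).
  move=> t1 /nbhs_box[r' r'0 Hr'].
  pose y := r' / (2 * (`|v.1| + `|v.2| + 1)).
  have M'0 : 0 < `|v.1| + `|v.2| + 1 by rewrite ltr_wpDl ?addr_ge0.
  have y0 : 0 < y by rewrite divr_gt0// mulr_gt0.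
  have yM : y * (`|v.1| + `|v.2| + 1) = r' / 2 by rewrite /y; field; rewrite gt_eqF.
  have yv1 : 0 <= y * `|v.1| by rewrite mulr_ge0// ltW.
  have yv2 : 0 <= y * `|v.2| by rewrite mulr_ge0// ltW.
  have Kt : K (l (t * (1 + y))).
    apply: Hr' => /=.
      have -> : t * (1 + y) * v.1 - t * v.1 = t * (y * v.1) by ring.
      by rewrite normrM t1 normrM (gtr0_norm y0); lra.
    have -> : t * (1 + y) * v.2 - t * v.2 = t * (y * v.2) by ring.
    by rewrite normrM t1 normrM (gtr0_norm y0); lra.
  have Ky : K (l (1 + y)).
    have := t1; have [t0|t0] := leP 0 t.
      by rewrite (ger0_norm t0) => tE; move: Kt; rewrite tE mul1r.
    rewrite (ltr0_norm t0) => tE; move: (symK Kt) => /=.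
    by congr K; congr pair; rewrite (_ : t = - 1); [ring|lra|ring|lra].
  have Aly : A (l (1 + y)).
    apply/AE; split => //; rewrite /g/=.
    have -> : e1 * ((1 + y) * v.1) + e2 * ((1 + y) * v.2) = (1 + y) * g v.
      by rewrite /g; ring.
    by rewrite gv mulr0.
  have := sv _ Aly => /=.
  have -> : - e2 * ((1 + y) * v.1) + e1 * ((1 + y) * v.2) = (1 + y) * s v.
    by rewrite /s; ring.
  by rewrite -/(s v); nra.
have img : A = l @` `[-1, 1].
  apply/seteqP; split => w; last first.
    move=> [t]; rewrite /= in_itv/= => t11 <-; apply/AE; split.
      by apply: Kl; rewrite ler_norml.
    have -> : g (l t) = t * g v by rewrite /g/l/=; ring.
    by rewrite gv mulr0.
  move=> Aw; have [Kw gw] := (AE w).1 Aw.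
  exists (s w / s v); last by rewrite {2}(vE w gw).
  rewrite /= in_itv/= ler_pdivrMr// ler_pdivlMr// mul1r mulN1r.
  apply/andP; split; last exact: sv.
  have Aw' : A (- w.1, - w.2).
    apply/AE; split; first exact: symK.
    have -> : g (- w.1, - w.2) = - g w by rewrite /g/=; ring.
    by rewrite gw oppr0.
  by have := sv _ Aw'; rewrite /s/=; lra.
split => /=.
- by apply: closedI => //; apply: closed_fun_ge; exact: cg.
- by apply: closedI => //; apply: closed_fun_le; exact: cg.
- apply/seteqP; split => w; last by case=> -[].
  by move=> Kw; have [h|/ltW h] := leP 0 (g w); [left|right].
exists l; last first.
  by rewrite -img; apply/seteqP; split => w; [move=> [[? ?] [_ ?]]|move=> [[? ?] ?]].
split => //.
- apply: continuous_subspaceT => t.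
  have ck (k : R) : (fun t : R => t * k) @ t --> t * k.
    by apply: cvgM; [exact: cvg_id|exact: cvg_cst].
  exact: cvg_pair (ck _) (ck _).
- by rewrite -img => w /AE[].
- move=> t; rewrite in_itv/= => t11.
  have Klt : K (l t) by apply: Kl; rewrite ler_norml.
  split; last first.
    move=> tE; split; first exact: subset_closure.
    by apply: notint; case: tE => ->; rewrite ?normrN normr1.
  move=> [_ nint].
  have [tp|tn] := leP 0 t.
    have [t1|t1] := ltP t 1; last by right; lra.
    by exfalso; apply: nint; apply: scale_interior => //; rewrite tp t1.
  have [t1|t1] := ltP (- 1) t; last by left; lra.
  exfalso; apply: nint.
  have := @scale_interior (- v.1, - v.2) (- t) (symK Kv) => /=.
  by rewrite /l !mulrNN; apply; lra.
Qed.

(** Reflection in the centre exchanges the two halves and preserves distances, so a bound on one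
    half controls both. *)
Lemma bisecting_diameter_le (e : plane R) M : e != (0, 0) ->
  (forall p q, K p -> K q -> 0 <= e.1 * p.1 + e.2 * p.2 ->
     0 <= e.1 * q.1 + e.2 * q.2 -> eucl_dist p q <= M) ->
  bisecting_diameter K <= M.
Proof.
move=> e0 H.
have K0 : K (0, 0) by apply: boxK; rewrite normr0.
have B := bisect_by_line e0.
set B0 := (X in bisections K X) in B.
apply: (@le_trans _ _ (Num.max (diam B0.1) (diam B0.2))).
  apply: ge_inf; last by exists B0.
  exists 0 => _ [[S1 S2] [/= _ _ KE _] <-].
  have S1K : S1 `<=` K by rewrite KE => w; left.
  rewrite le_max; apply/orP; left.
  (* On an empty piece [diam] is the default value 0 of [sup]. *)
  have [S0|/set0P[p Sp]] := eqVneq S1 set0.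
    by rewrite /diam S0 set0X image_set0 sup0.
  exact: le_trans (eucl_dist_ge0 p p) (le_diam cK S1K Sp Sp).
rewrite ge_max; apply/andP; split; apply: diam_le.
- by exists (0, 0); split => //=; rewrite !mulr0 addr0.
- by move=> p q [Kp /= gp] [Kq /= gq]; exact: H.
- by exists (0, 0); split => //=; rewrite !mulr0 addr0.
- move=> p q [Kp /= gp] [Kq /= gq].
  have -> : eucl_dist p q = eucl_dist (- p.1, - p.2) (- q.1, - q.2).
    by rewrite /eucl_dist/=; congr Num.sqrt; ring.
  by apply: H; [exact: symK|exact: symK| |]; rewrite /=; lra.
Qed.

(** Guards the ratio: division by 0 returns 0, so an upper bound on the bisecting diameter alone
    would not bound the ratio from below. *)
Lemma bisecting_diameter_gt0 : 0 < bisecting_diameter K.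
Proof.
have r2 : 0 < r / 2 by rewrite divr_gt0.
apply: (@lt_le_trans _ _ (r / 2)) => //.
apply: lb_le_inf.
  have e0 : (1, 0) != (0, 0) :> plane R by rewrite xpair_eqE oner_eq0.
  by eexists; exists (K `&` [set w | 0 <= 1 * w.1 + 0 * w.2],
                K `&` [set w | 1 * w.1 + 0 * w.2 <= 0]); first exact: bisect_by_line e0.
move=> _ [[S1 S2] [/= _ _ KE _] <-].
have S1K : S1 `<=` K by rewrite KE => w; left.
have S2K : S2 `<=` K by rewrite KE => w; right.
have Ka : K (0, 0) by apply: boxK; rewrite normr0.
have Kb : K (r / 2, 0) by apply: boxK; rewrite ?normr0//= gtr0_norm//; lra.
have Kc : K (0, r / 2) by apply: boxK; rewrite ?normr0//= gtr0_norm//; lra.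
have dist_ge p q : (r / 2) ^+ 2 <= (p.1 - q.1) ^+ 2 + (p.2 - q.2) ^+ 2 ->
    r / 2 <= eucl_dist p q.
  by move=> h; rewrite /eucl_dist -[leLHS]gtr0_norm// -sqrtr_sqr ler_wsqrtr.
(* Pigeonhole: two of the three points lie in the same piece. *)
have pair p q : K p -> K q ->
    (r / 2) ^+ 2 <= (p.1 - q.1) ^+ 2 + (p.2 - q.2) ^+ 2 ->
    (S1 p /\ S1 q) \/ (S2 p /\ S2 q) ->
    r / 2 <= Num.max (diam S1) (diam S2).
  move=> Kp Kq /dist_ge h [[S1p S1q]|[S2p S2q]]; rewrite le_max; apply/orP.
    by left; exact: le_trans h (le_diam cK S1K S1p S1q).
  by right; exact: le_trans h (le_diam cK S2K S2p S2q).
have dab := pair _ _ Ka Kb; have dac := pair _ _ Ka Kc; have dbc := pair _ _ Kb Kc.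
move: Ka Kb Kc; rewrite KE => -[a|a] [b|b] [c|c].
all: first [by apply: dab; [rewrite /=; nra|tauto]
           |by apply: dac; [rewrite /=; nra|tauto]
           |by apply: dbc; [rewrite /=; nra|tauto]].
Qed.

End SymmetricBody.

End Bisections.

(** * Area of a centrally symmetric body from chords of one half *)

Section SymmetricArea.
Context {R : realType}.
Local Notation mu := (@lebesgue_measure R).
Local Notation mT := (measurableTypeR R).
Implicit Types (K : set (plane R)) (e p q : plane R).

(** [area] sends an infinite measure to 0, so a lower bound on the measure passes to [area] only
    once finiteness is known. *)
Lemma compact_area_fin K : compact K -> ((mu \x mu) K < +oo)%E.
Proof.
move=> cK.
have [M1 M10 H1] := compact_ubound cK (@linear_form_continuous R (1, 0)).
have [M2 M20 H2] := compact_ubound cK (@linear_form_continuous R (- 1, 0)).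
have [M3 M30 H3] := compact_ubound cK (@linear_form_continuous R (0, 1)).
have [M4 M40 H4] := compact_ubound cK (@linear_form_continuous R (0, - 1)).
pose B : set (plane R) := `[- M2, M1] `*` `[- M4, M3].
apply: (@le_lt_trans _ _ ((mu \x mu) B)%E).
  apply: le_measure; rewrite ?inE.
  - by apply: closed_measurable_plane; exact: compact_closed.
  - by apply: (@measurableX _ _ mT mT); exact: measurable_itv.
  - move=> w Kw; have := H1 _ Kw; have := H2 _ Kw; have := H3 _ Kw; have := H4 _ Kw.
    move=> /= *; split; rewrite /= in_itv/=; apply/andP; split; lra.
rewrite /B product_measure1E; [|exact: measurable_itv|exact: measurable_itv].
have fin (a b : R) : (mu `[a, b] < +oo)%E.
  by rewrite lebesgue_measure_itv/=; case: ifP => _; rewrite -?EFinB ltry.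
apply: lte_mul_pinfty => //; last exact: fin.
by rewrite ge0_fin_numE//; exact: fin.
Qed.

(** The chord and the points of one half, reflected in the centre, serve the other, so each half has
    measure at least [h * (p2.1 - q2.1) / 2]. The halves share only points of a line, which is
    null. *)
Lemma symmetric_chord_area K e p1 q1 p2 q2 h :
  compact K -> segment_closed K ->
  (forall q, K q -> K (- q.1, - q.2)) -> e != (0, 0) ->
  (forall q, q \in [:: p1; q1; p2; q2] -> K q /\ 0 <= e.1 * q.1 + e.2 * q.2) ->
  0 <= h -> p1 = (q1.1, q1.2 + h) ->
  ((h * (p2.1 - q2.1))%:E <= (mu \x mu) K)%E.
Proof.
move=> cK sK symK e0 He h0 p1E.
have [Kp1 gp1] : K p1 /\ 0 <= e.1 * p1.1 + e.2 * p1.2 by apply: He; rewrite !inE eqxx.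
have [Kq1 gq1] : K q1 /\ 0 <= e.1 * q1.1 + e.2 * q1.2.
  by apply: He; rewrite !inE eqxx orbT.
have [Kp2 gp2] : K p2 /\ 0 <= e.1 * p2.1 + e.2 * p2.2.
  by apply: He; rewrite !inE eqxx !orbT.
have [Kq2 gq2] : K q2 /\ 0 <= e.1 * q2.1 + e.2 * q2.2.
  by apply: He; rewrite !inE eqxx !orbT.
pose g (w : plane R) := e.1 * w.1 + e.2 * w.2.
have cg : continuous g := @linear_form_continuous R e.
have cKc : closed K by exact: compact_closed.
pose L := K `&` [set w | 0 <= g w]; pose L' := K `&` [set w | g w <= 0].
pose N := [set w | g w = 0].
have cN : closed N.
  have -> : N = [set w | 0 <= g w] `&` [set w | g w <= 0].
    apply/seteqP; split => w; rewrite /N/=; first by move=> ->.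
    by move=> [h1 h2]; apply/eqP; rewrite eq_le h1 h2.
  by apply: closedI; [exact: closed_fun_ge|exact: closed_fun_le].
have mL : measurable (L : set (mT * mT)).
  by apply: closed_measurable_plane; apply: closedI => //; exact: closed_fun_ge.
have mL' : measurable (L' : set (mT * mT)).
  by apply: closed_measurable_plane; apply: closedI => //; exact: closed_fun_le.
have mN : measurable (N : set (mT * mT)) by exact: closed_measurable_plane.
have mK : measurable (K : set (mT * mT)) by exact: closed_measurable_plane.
have gD p q t : g (t * p.1 + (1 - t) * q.1, t * p.2 + (1 - t) * q.2) =
    t * g p + (1 - t) * g q by rewrite /g/=; ring.
have sL : segment_closed L.
  move=> p q t t01 [Kp /= gp] [Kq /= gq]; split; first exact: sK.
  have /andP[t0 t1] := t01; rewrite /= gD.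
  by rewrite addr_ge0// mulr_ge0// subr_ge0.
have sL' : segment_closed L'.
  move=> p q t t01 [Kp /= gp] [Kq /= gq]; split; first exact: sK.
  have /andP[t0 t1] := t01; rewrite /= gD.
  by rewrite -oppr_ge0 opprD addr_ge0// -mulrN mulr_ge0// ?subr_ge0 ?oppr_ge0.
have LN q : L q -> L' (- q.1, - q.2).
  move=> [Kq /= gq]; split; first exact: symK.
  by move: gq; rewrite /g/=; lra.
have A1 : ((h * (p2.1 - q2.1) / 2)%:E <= (mu \x mu) L)%E.
  apply: (@chord_area _ L q1.1 q1.2) => //; first by split; case: (q1) Kq1 gq1.
  by rewrite -p1E.
have A2 : ((h * (p2.1 - q2.1) / 2)%:E <= (mu \x mu) L')%E.
  have -> : h * (p2.1 - q2.1) / 2 = h * (- q2.1 - - p2.1) / 2 by ring.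
  apply: (@chord_area _ L' (- q1.1) (- p1.2) h mL' sL' _ _
    (- p2.1, - p2.2) (- q2.1, - q2.2) h0).
  - by have := @LN p1 (conj Kp1 gp1); rewrite p1E.
  - have := @LN q1 (conj Kq1 gq1); rewrite p1E/=.
    by congr L'; congr pair; ring.
  - exact: LN.
  - exact: LN.
have null (S : set (mT * mT)) : measurable S ->
    ((mu \x mu) S = (mu \x mu) (S `\` N))%E.
  move=> mS.
  have z : ((mu \x mu) (S `&` N) = 0)%E.
    apply/eqP; rewrite eq_le measure_ge0 andbT.
    have <- : ((mu \x mu) N = 0)%E by apply: line_null; case: (e) e0.
    by apply: le_measure; rewrite ?inE//; exact: measurableI.
  transitivity ((mu \x mu) (S `\` N) + (mu \x mu) (S `&` N))%E.
    exact: measureDI.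
  by rewrite z adde0.
have := leeD A1 A2; rewrite -EFinD (null L)// (null L')//.
have -> : h * (p2.1 - q2.1) / 2 + h * (p2.1 - q2.1) / 2 = h * (p2.1 - q2.1) by field.
move=> /le_trans; apply.
rewrite -measureU; last 3 first.
- exact: measurableD.
- exact: measurableD.
- apply/seteqP; split => // w [[[_ /= h1] h2] [[_ /= h3] _]].
  by apply: h2; apply/eqP; rewrite eq_le h1 h3.
apply: le_measure; rewrite ?inE//.
  by apply: measurableU; exact: measurableD.
by move=> w [[[]]|[[]]].
Qed.

End SymmetricArea.

(** * The affine image *)

Section EllipseMap.
Context {R : realType}.
Variables (s a b c : R) (u : plane R).

(* With [s ^+ 2 = a * b - c ^+ 2], this is an isometry from the form
   [qform a b c] to the Euclidean plane; it makes [u] vertical. *)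
Definition ellipse_map (w : plane R) : plane R := (s * cross u w, qpolar a b c u w).

Fact ellipse_map_is_linear : linear ellipse_map.
Proof.
move=> k w w'; rewrite /ellipse_map /cross /qpolar.
by congr pair; rewrite /= /GRing.scale/=; ring.
Qed.

HB.instance Definition _ := GRing.isLinear.Build R (plane R) (plane R) *:%R
  ellipse_map ellipse_map_is_linear.

(** This is [z.2] times [u] plus [z.1] times u', where u' is orthogonal to [u] for the form and,
    when [u] has length 1, is scaled so that [s * cross u u'] is 1. *)
Definition ellipse_map_inv (z : plane R) : plane R :=
  (u.1 * z.2 - (c * u.1 + b * u.2) * z.1 / s,
   u.2 * z.2 + (a * u.1 + c * u.2) * z.1 / s).

Hypotheses (s0 : s != 0) (u1 : qform a b c u = 1).

Lemma ellipse_mapK : cancel ellipse_map ellipse_map_inv.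
Proof.
move=> [x y]; rewrite /ellipse_map_inv /ellipse_map /cross /qpolar/=.
(* Writing 1 as the form at [u] turns the claim into an identity of rational functions. *)
rewrite -[in RHS](mul1r x) -[in RHS](mul1r y) -u1 /qform.
by congr pair; field.
Qed.

Lemma ellipse_map_invK : cancel ellipse_map_inv ellipse_map.
Proof.
move=> [x y]; rewrite /ellipse_map_inv /ellipse_map /cross /qpolar/=.
rewrite -[in RHS](mul1r x) -[in RHS](mul1r y) -u1 /qform.
by congr pair; field.
Qed.

Lemma ellipse_map_bij : bijective ellipse_map.
Proof. by exists ellipse_map_inv; [exact: ellipse_mapK|exact: ellipse_map_invK]. Qed.

End EllipseMap.

Section Main.
Context {R : realType}.
Implicit Types K : set (plane R).

Lemma affine_image_ratio_ge K : convex_body K -> centrally_symmetric K ->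
  exists2 phi, nonsingular_affine phi &
    Num.sqrt 3 / 2 <= isodiametric_ratio (phi @` K).
Proof.
move=> [/convex_set_segment_closed sK cK [z0 z0K]] [x KE].
have symK y : K y -> K (x.1 - y.1, x.2 - y.2) by move=> Ky; rewrite KE; exists y.
pose o : plane R := (x.1 / 2, x.2 / 2).
have [r r0 boxK] : exists2 r, 0 < r & forall q,
    `|q.1 - o.1| < r -> `|q.2 - o.2| < r -> K q.
  have [r r0 Hr] := nbhs_box z0K.
  exists (r / 2); first by rewrite divr_gt0.
  move=> q q1 q2.
  (* The midpoint of this point and the reflection of [z0] is [q]: a box around [z0] yields one of
     half the size around the centre. *)
  have Ka : K (z0.1 + 2 * (q.1 - o.1), z0.2 + 2 * (q.2 - o.2)).
    by apply: Hr; rewrite /= addrAC subrr add0r normrM ger0_norm//; lra.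
  have Kz0 : K z0 by exact: interior_subset.
  have t01 : 0 <= (1 / 2 : R) <= 1 by lra.
  have := sK _ _ _ t01 Ka (symK _ Kz0) => /=.
  by rewrite [in X in _ -> X](surjective_pairing q); congr K; congr pair;
    rewrite /o/=; field.
have Ko : K o by apply: boxK; rewrite subrr normr0.
pose L := K `&` [set w | o.1 <= w.1].
have cL : compact L.
  apply: compact_closedI => //; apply: closed_fun_ge => w; exact: cvg_fst.
pose W := (fun y : plane R * plane R => y.1 - y.2) @` (L `*` L).
have cW : compact W.
  apply: continuous_compact; last exact: compact_setX.
  apply: continuous_subspaceT => y.
  by apply: cvgB; [exact: cvg_fst|exact: cvg_snd].
pose t := r / 2.
have t0 : 0 < t by rewrite divr_gt0.
have tr : t < r by rewrite /t; lra.
have inL (y1 y2 : R) : 0 <= y1 < r -> `|y2| < r -> L (o.1 + y1, o.2 + y2).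
  move=> /andP[y10 y1r] y2r; split; last by rewrite /= lerDl.
  by apply: boxK; rewrite /= addrAC subrr add0r// ger0_norm.
(* Subtracting the centre from the right half of the box gives differences with nonnegative first
   coordinate; the four points asked for by [large_contact_cross] are of this kind. *)
have inW (y1 y2 : R) : 0 <= y1 < r -> `|y2| < r -> W (y1, y2).
  move=> h1 h2; exists ((o.1 + y1, o.2 + y2), (o.1 + 0, o.2 + 0)).
    by split; apply: inL; rewrite ?normr0 ?lexx.
  by congr pair; rewrite /=; ring.
have t01 : 0 <= t < r by rewrite ltW.
have z01 : 0 <= (0 : R) < r by rewrite lexx.
have tn : `|t| < r by rewrite gtr0_norm.
have zn : `|0 : R| < r by rewrite normr0.
have ntn : `|- t| < r by rewrite normrN.
have [a [b [c [u [v [d0 QW [Wu Wv] Qu cuv]]]]]] :=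
  large_contact_cross t0 cW (inW _ _ t01 zn) (inW _ _ z01 tn) (inW _ _ t01 tn)
    (inW _ _ t01 ntn).
pose s := Num.sqrt (a * b - c ^+ 2).
have s0 : 0 < s by rewrite sqrtr_gt0.
have sn : s != 0 by rewrite gt_eqF.
have s2 : s ^+ 2 = a * b - c ^+ 2 by rewrite sqr_sqrtr// ltW.
pose T := ellipse_map s a b c u.
pose T' := ellipse_map_inv s a b c u.
have TK : cancel T T' by exact: ellipse_mapK.
have T'K : cancel T' T by exact: ellipse_map_invK.
have TD w w' : T (w + w') = T w + T w' by exact: linearD.
have TB w w' : T (w - w') = T w - T w' by exact: linearB.
pose phi (w : plane R) := T w + - T o.
have aff : nonsingular_affine phi.
  by exists T, (- T o); split => //; exact: ellipse_map_bij.
exists phi => //.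
pose psi (z : plane R) := T' z + o.
have phiK : cancel phi psi by move=> w; rewrite /phi/psi -TB TK subrK.
have psiK : cancel psi phi by move=> w; rewrite /phi/psi TD T'K addrK.
set K' := phi @` K.
have K'E z : K' z <-> K (psi z).
  split; first by move=> [w Kw <-]; rewrite phiK.
  by move=> Kz; exists (psi z).
have cpsi1 : continuous (fun z => (psi z).1).
  move=> z; apply: cvgD; last exact: cvg_cst.
  apply: cvgB; first by apply: cvgM; [exact: cvg_cst|exact: cvg_snd].
  by apply: cvgM; last exact: cvg_cst; apply: cvgM; [exact: cvg_cst|exact: cvg_fst].
have cpsi2 : continuous (fun z => (psi z).2).
  move=> z; apply: cvgD; last exact: cvg_cst.
  apply: cvgD; first by apply: cvgM; [exact: cvg_cst|exact: cvg_snd].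
  by apply: cvgM; last exact: cvg_cst; apply: cvgM; [exact: cvg_cst|exact: cvg_fst].
have cphi : continuous phi.
  move=> w.
  have c1 : (fun w => (phi w).1) @ w --> (phi w).1.
    apply: cvgB; last exact: cvg_cst.
    apply: cvgM; first exact: cvg_cst.
    by apply: cvgB; apply: cvgM; first [exact: cvg_cst|exact: cvg_fst|exact: cvg_snd].
  have c2 : (fun w => (phi w).2) @ w --> (phi w).2.
    apply: cvgB; last exact: cvg_cst.
    apply: cvgD; last by apply: cvgM; [exact: cvg_cst|exact: cvg_snd].
    apply: cvgD; first by apply: cvgM; [exact: cvg_cst|exact: cvg_fst].
    apply: cvgM; first exact: cvg_cst.
    by apply: cvgD; apply: cvgM; first [exact: cvg_cst|exact: cvg_fst|exact: cvg_snd].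
  exact: cvg_pair c1 c2.
have cK' : compact K' by apply: continuous_compact => //; exact: continuous_subspaceT.
have sK' : segment_closed K'.
  move=> p q k k01 /K'E Kp /K'E Kq; apply/K'E.
  have := sK _ _ _ k01 Kp Kq.
  congr K; rewrite [RHS]surjective_pairing /psi /T' /ellipse_map_inv/=.
  by congr pair; field.
have symK' q : K' q -> K' (- q.1, - q.2).
  move=> /K'E /symK Kq; apply/K'E; move: Kq.
  congr K; rewrite [RHS]surjective_pairing /psi /T' /ellipse_map_inv/=.
  by congr pair; field.
have psi0 : psi (0, 0) = o.
  by rewrite /psi /T' /ellipse_map_inv [RHS]surjective_pairing; congr pair; rewrite /=; ring.
have [r' r'0 boxK'] : exists2 r', 0 < r' & forall q, `|q.1| < r' -> `|q.2| < r' -> K' q.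
  have n1 : nbhs ((0, 0) : plane R) [set z | `|(psi z).1 - o.1| < r].
    have h : (fun z => (psi z).1) @ ((0, 0) : plane R) --> o.1.
      by rewrite -psi0; exact: cpsi1.
    exact: cvgr_distC_lt h _ r0.
  have n2 : nbhs ((0, 0) : plane R) [set z | `|(psi z).2 - o.2| < r].
    have h : (fun z => (psi z).2) @ ((0, 0) : plane R) --> o.2.
      by rewrite -psi0; exact: cpsi2.
    exact: cvgr_distC_lt h _ r0.
  have [r' r'0 Hr'] := nbhs_box (filterI n1 n2).
  exists r' => // q q1 q2; apply/K'E.
  by have [] := Hr' q; rewrite /= ?subr0// => h1 h2; exact: boxK.
(* The linear part of the first coordinate of [psi]: its kernel is the image of the cutting line. *)
pose e : plane R := (- (c * u.1 + b * u.2) / s, u.1).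
have ez z : e.1 * z.1 + e.2 * z.2 = (psi z).1 - o.1.
  by rewrite /e /psi /T' /ellipse_map_inv/=; field.
have e0 : e != (0, 0).
  apply/negP => /eqP[/eqP].
  rewrite mulf_eq0 invr_eq0 (negPf sn) orbF oppr_eq0 => /eqP e1 e2.
  have /eqP : qform a b c u = 0.
    transitivity (u.1 * (a * u.1 + c * u.2) + u.2 * (c * u.1 + b * u.2)).
      by rewrite /qform; ring.
    by rewrite e1 e2; ring.
  by rewrite Qu oner_eq0.
have inW' p q : K' p -> K' q -> 0 <= e.1 * p.1 + e.2 * p.2 ->
    0 <= e.1 * q.1 + e.2 * q.2 -> W (psi p - psi q).
  move=> /K'E Kp /K'E Kq; rewrite !ez !subr_ge0 => hp hq.
  by exists (psi p, psi q).
have distE p q : eucl_dist p q = Num.sqrt (qform a b c (psi p - psi q)).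
  rewrite /eucl_dist; congr Num.sqrt.
  rewrite -[RHS]mul1r -Qu -qform_cross -s2.
  have Tpq : T (psi p - psi q) = p - q by rewrite TB /psi !TD !T'K; ring.
  have <- : s * cross u (psi p - psi q) = p.1 - q.1 := congr1 fst Tpq.
  have <- : qpolar a b c u (psi p - psi q) = p.2 - q.2 := congr1 snd Tpq.
  by rewrite exprMn addrC.
have DBle : bisecting_diameter K' <= 1.
  apply: (bisecting_diameter_le r'0 cK' sK' boxK' symK' e0) => p q Kp Kq gp gq.
  by rewrite distE -sqrtr1 ler_wsqrtr// QW//; exact: inW'.
have DBgt : 0 < bisecting_diameter K'.
  exact: (bisecting_diameter_gt0 r'0 cK' sK' boxK' symK').
have areage : ((Num.sqrt 3 / 2)%:E <=
    (@lebesgue_measure R \x @lebesgue_measure R) K')%E.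
  move: Wu Wv => [[p1 q1] [/= Lp1 Lq1] uE] [[p2 q2] [/= Lp2 Lq2] vE].
  have inK' p : L p -> K' (phi p) /\ 0 <= e.1 * (phi p).1 + e.2 * (phi p).2.
    by move=> [Kp po]; split; [exists p|rewrite ez phiK subr_ge0].
  have phiB p q : phi p - phi q = T (p - q) by rewrite TB /phi; ring.
  have Tu : T u = (0, 1).
    rewrite /T /ellipse_map; congr pair; first by rewrite /cross; ring.
    by rewrite -Qu /qpolar /qform; ring.
  have chord : phi p1 = ((phi q1).1, (phi q1).2 + 1).
    rewrite -[LHS](subrK (phi q1)) phiB uE Tu; congr pair => /=; ring.
  (* [s * cross u v] is the horizontal component of the image of [v], the image of [u] being
     vertical of length 1. *)
  have cle : Num.sqrt 3 / 2 <= `|s * cross u v|.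
    rewrite -sqrtr_sqr exprMn s2 -[leLHS]ger0_norm; last first.
      by rewrite divr_ge0// sqrtr_ge0.
    rewrite -sqrtr_sqr ler_wsqrtr// exprMn sqr_sqrtr//.
    by apply: le_trans cuv; rewrite exprVn; lra.
  have vx : (phi p2).1 - (phi q2).1 = s * cross u v.
    by have := phiB p2 q2; rewrite vE => /(congr1 fst).
  have Harea p q : L p -> L q ->
      (((phi p).1 - (phi q).1)%:E <=
       (@lebesgue_measure R \x @lebesgue_measure R) K')%E.
    move=> Lp Lq; rewrite -[X in X%:E]mul1r.
    apply: (symmetric_chord_area cK' sK' symK' e0 _ _ chord) => // w.
    by rewrite !inE => /or4P[]/eqP->; exact: inK'.
  (* If the image of [v] points to the left, its two ends are exchanged. *)
  have [cp|cp] := leP 0 (s * cross u v).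
    apply: le_trans (Harea _ _ Lp2 Lq2).
    by rewrite lee_fin vx; move: cle; rewrite ger0_norm.
  apply: le_trans (Harea _ _ Lq2 Lp2).
  by rewrite lee_fin -opprB vx; move: cle; rewrite ltr0_norm.
rewrite /isodiametric_ratio.
have A : Num.sqrt 3 / 2 <= area K'.
  rewrite /area -lee_fin fineK//.
  by rewrite ge0_fin_numE; [exact: compact_area_fin|exact: measure_ge0].
apply: le_trans A _.
have A0 : 0 <= area K' by rewrite /area fine_ge0// measure_ge0.
by rewrite ler_pdivlMr ?exprn_gt0// ler_piMr// expr_le1// ltW.
Qed.

End Main.

Theorem theorem1p8 (R : realType) (K : set (plane R))
    (bodyK : convex_body K) (symK : centrally_symmetric K)
    (posK : behrend_bisecting_position K) :
  area K / bisecting_diameter K ^+ 2 >= Num.sqrt 3 / 2.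
Proof.
have [phi aff ratio] := affine_image_ratio_ge bodyK symK.
apply: (le_trans ratio).
rewrite -/(isodiametric_ratio K) -lee_fin posK.
by apply: ereal_sup_ubound; exists phi.
Qed.
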